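(* The group of intermediate growth $\mathcal{G}_{(01)^\infty}$ embeds (i.e., admits an injective group homomorphism) into the topological full group $[[\sigma_{\{0,1\}}|\Omega(\xi_{\mathrm{TM}})]]$ of the substitution subshift generated by the Thue-Morse substitution, as well as into the topological full group $[[\sigma_{\{x,y\}}|\Omega(\xi_{\mathrm{pd}})]]$ of the substitution subshift generated by the period doubling substitution.
   Context: Subshifts. An alphabet $\mathcal{A}$ is a finite set with more than one element; $\mathbb{N}=\{1,2,\dots\}$. $\mathcal{A}^{\mathbb{Z}}$ is the set of bi-infinite strings $\ldots x_{-1}x_0.x_1x_2\ldots$ (functions $\mathbb{Z}\to\mathcal{A}$, $i\mapsto x_i$) with the product topology, $\mathcal{A}$ being discrete. The shift $\sigma_{\mathcal{A}}:\mathcal{A}^{\mathbb{Z}}\to\mathcal{A}^{\mathbb{Z}}$ is given by $(\sigma_{\mathcal{A}}(\omega))(n)=\omega(n+1)$. For an infinite string $\xi=x_1x_2x_3\ldots\in\mathcal{A}^{\mathbb{N}}$, $\Omega(\xi)$ is the set of all $\omega\in\mathcal{A}^{\mathbb{Z}}$ such that every (finite, nonempty, contiguous) subword of $\omega$ is also a subword of $\xi$; it is nonempty, closed and satisfies $\sigma_{\mathcal{A}}(\Omega(\xi))=\Omega(\xi)$, and $\sigma_{\mathcal{A}}|\Omega(\xi)$ denotes the restriction of the shift to it. A substitution over $\mathcal{A}$ assigns to each letter a nonempty word and is applied to strings letter by letter with concatenation. $\xi_{\mathrm{TM}}\in\{0,1\}^{\mathbb{N}}$ is the unique infinite string beginning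 with $0$ preserved by the Thue-Morse substitution $0\to01$, $1\to10$. $\xi_{\mathrm{pd}}\in\{x,y\}^{\mathbb{N}}$ is the unique infinite string beginning with $x$ preserved by the period doubling substitution $x\to xy$, $y\to xx$. Both sets $\Omega(\xi_{\mathrm{TM}})$ and $\Omega(\xi_{\mathrm{pd}})$ are Cantor sets. Topological full group. For a homeomorphism $T:X\to X$ of a Cantor set $X$, $[[T]]$ is the group (under composition) of all homeomorphisms $F:X\to X$ of the form $F(x)=T^{\nu(x)}(x)$, $x\in X$, for some continuous function $\nu:X\to\mathbb{Z}$. The group. For $\omega\in\{0,1,2\}^{\mathbb{N}}$, $\mathcal{G}_\omega$ is the group of transformations of $\{0,1\}^{\mathbb{N}}$ generated by $a,b_\omega,c_\omega,d_\omega$, where $a(0\eta)=1\eta$, $a(1\eta)=0\eta$, and for all $\eta\in\{0,1\}^{\mathbb{N}}$, $l\in\{0,1,2\}$, $\omega\in\{0,1,2\}^{\mathbb{N}}$: $b_{2\omega}(0\eta)=c_{1\omega}(0\eta)=d_{0\omega}(0\eta)=0\eta$; $b_{0\omega}(0\eta)=b_{1\omega}(0\eta)=c_{0\omega}(0\eta)=c_{2\omega}(0\eta)=d_{1\omega}(0\eta)=d_{2\omega}(0\eta)=0a(\eta)$; $b_{l\omega}(1\eta)=1b_\omega(\eta)$, $c_{l\omega}(1\eta)=1c_\omega(\eta)$, $d_{l\omega}(1\eta)=1d_\omega(\eta)$. One has $b_\omega=c_\omega d_\omega$. $\mathcal{G}_{(01)^\infty}$ is the group for $\omega=(01)^\infty=010101\ldots$.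 That this group has intermediate growth (growth faster than polynomial and slower than exponential) is a previously known fact. *)

(* Defs.v *)
From HB Require Import structures.
From mathcomp Require Import all_boot all_order all_algebra.
From mathcomp Require Import all_classical all_reals.
From mathcomp Require Import topology.

Set Implicit Arguments.
Unset Strict Implicit.
Unset Printing Implicit Defensive.

Local Open Scope classical_set_scope.
Local Open Scope group_scope.

Section Groups.
Variable G : groupType.

Definition expgz (g : G) (n : int) : G :=
  match n with Posz m => g ^+ m | Negz m => g ^- m.+1 end.

Lemma expgzS (g : G) (n : int) : expgz g (1 + n)%R = g * expgz g n.
Proof.
case: n => [n|[|n]].
- by rewrite -PoszD /= expgS.
- by rewrite /= mulgV.
- have -> : (1 + Negz n.+1)%R = Negz n.
    by rewrite !NegzE -(addn1 n.+1) addnC PoszD GRing.opprD GRing.addNKr.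
  by rewrite /= [in RHS]expgSr invgM mulgA mulgV mul1g.
Qed.

Lemma expgzD (g : G) (m n : int) : expgz g (m + n)%R = expgz g m * expgz g n.
Proof.
elim/int_ind: m => [|m IH|m IH].
- by rewrite GRing.add0r /= mul1g.
- by rewrite -add1n PoszD -GRing.addrA !expgzS IH mulgA.
- apply: (@mulgI _ g); rewrite -expgzS mulgA -expgzS -add1n PoszD GRing.opprD.
  by rewrite -GRing.addrA !GRing.addNKr IH.
Qed.

Lemma expgzN (g : G) (n : int) : expgz g (- n)%R = (expgz g n)^-1.
Proof. by apply: (@mulgI _ (expgz g n)); rewrite -expgzD GRing.subrr mulgV. Qed.

Definition subgroup (H : set G) : Prop := group_closed [in H].

Definition generated (S : set G) : set G := smallest subgroup S.

Lemma generated_closed (S : set G) : subgroup (generated S).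
Proof.
split=> [|x y].
- by apply/mem_set => H [[H1 _] _]; exact/set_mem.
- move=> /set_mem Sx /set_mem Sy; apply/mem_set => H /[dup] HH [[_ Hd] _].
  by apply/set_mem/Hd; apply/mem_set; [exact: Sx | exact: Sy].
Qed.

Definition generated_group (S : set G) : Type := {g : G | g \in generated S}.

HB.instance Definition _ S := SubChoice.on (generated_group S).
HB.instance Definition _ (S : set G) :=
  SubChoice_isSubGroup.Build G _ (generated_group S) (generated_closed S).

End Groups.

Definition embeds (G H : groupType) : Prop :=
  exists f : {multiplicative G -> H}, injective f.

Record bijection (X : Type) := Bijection {
  bij_fun :> X -> X;
  bij_inv : X -> X;
  bij_funK : cancel bij_fun bij_inv;
  bij_invK : cancel bij_inv bij_fun }.

Section BijectionGroup.
Variable X : Type.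
Implicit Types F G : bijection X.

Lemma bijectionP F G : (forall x, F x = G x) -> F = G.
Proof.
case: F G => [f f' fK f'K] [g g' gK g'K] /= fg.
have fgE : f = g by apply/funext.
have fgE' : f' = g' by apply/funext => x; rewrite -[x in LHS]g'K -fg fK.
by subst; congr Bijection; exact: Prop_irrelevance.
Qed.

HB.instance Definition _ := gen_eqMixin (bijection X).
HB.instance Definition _ := gen_choiceMixin (bijection X).

Definition bij_one : bijection X := @Bijection X id id (fun=> erefl) (fun=> erefl).

Definition bij_opp F : bijection X := Bijection (@bij_invK _ F) (@bij_funK _ F).

Definition bij_mul F G : bijection X :=
  Bijection (can_comp (@bij_funK _ F) (@bij_funK _ G))
            (can_comp (@bij_invK _ G) (@bij_invK _ F)).

Fact bij_mulA : associative bij_mul. Proof. by move=> *; exact: bijectionP. Qed.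
Fact bij_mul1 : left_id bij_one bij_mul. Proof. by move=> *; exact: bijectionP. Qed.
Fact bij_1mul : right_id bij_one bij_mul. Proof. by move=> *; exact: bijectionP. Qed.
Fact bij_mulV : left_inverse bij_one bij_opp bij_mul.
Proof. by move=> F; apply: bijectionP => x; exact: bij_funK. Qed.
Fact bij_Vmul : right_inverse bij_one bij_opp bij_mul.
Proof. by move=> F; apply: bijectionP => x; exact: bij_invK. Qed.

HB.instance Definition _ :=
  isGroup.Build (bijection X) bij_mulA bij_mul1 bij_1mul bij_mulV bij_Vmul.

Lemma bijM F G x : (F * G)%g x = F (G x). Proof. by []. Qed.

End BijectionGroup.

Section FullGroup.
Variable X : topologicalType.

Definition homeomorphism (F : bijection X) : Prop :=
  continuous F /\ continuous (F^-1%g : bijection X).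

(* The group axioms below need neither that [X] is a Cantor set nor that [T] is
   a homeomorphism; the latter is [shift_Omega_homeomorphism] for subshifts. *)
Definition full_group_set (T : bijection X) : set (bijection X) :=
  [set F | homeomorphism F /\
    exists nu : X -> discrete_topology int,
      continuous nu /\ forall x, F x = expgz T (nu x) x].

Lemma full_group_closed (T : bijection X) : subgroup (full_group_set T).
Proof.
have H1 : full_group_set T 1.
  split; first by split=> x; exact: cvg_id.
  exists (fun=> 0%R); split=> // x; exact: cvg_cst.
have HV F : full_group_set T F -> full_group_set T F^-1%g.
  move=> [[cF cV] [nu [cnu FE]]]; split; first by split; rewrite ?invgK.
  exists (fun x => - nu ((F^-1)%g x))%R; split=> [x|x].
    have cn : continuous (nu \o (F^-1%g : bijection X)).
      by move=> y; apply: continuous_comp; [exact: cV | exact: cnu].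
    have /discrete_cvg/= h := cn x; apply/discrete_cvg.
    by apply: filterS h => y /= <-.
  rewrite expgzN; set y := (F^-1)%g x.
  have -> : x = F y by rewrite [RHS](@bij_invK _ F).
  by rewrite FE [RHS](@bij_funK _ (expgz T (nu y))).
have HM F G : full_group_set T F -> full_group_set T G -> full_group_set T (F * G)%g.
  move=> [[cF cF'] [nu [cnu FE]]] [[cG cG'] [mu [cmu GE]]]; split.
    split=> x; rewrite ?invgM; apply: continuous_comp;
    [exact: cG | exact: cF | exact: cF' | exact: cG'].
  exists (fun x => nu (G x) + mu x)%R; split=> [x|x].
    have cn : continuous (nu \o G).
      by move=> y; apply: continuous_comp; [exact: cG | exact: cnu].
    have /discrete_cvg/= h := cn x; have /discrete_cvg/= k := cmu x.
    by apply/discrete_cvg; apply: filterS2 h k => y /= -> ->.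
  by rewrite expgzD !bijM -GE FE.
split=> [|F G]; first exact/mem_set.
by move=> /set_mem HF /set_mem HG; apply/mem_set/HM => //; exact: HV.
Qed.

Definition full_group (T : bijection X) : Type :=
  {F : bijection X | F \in full_group_set T}.

HB.instance Definition _ T := SubChoice.on (full_group T).
HB.instance Definition _ (T : bijection X) :=
  SubChoice_isSubGroup.Build (bijection X) _ (full_group T) (full_group_closed T).

End FullGroup.

Section Subshifts.
Variable A : finType.

Definition bistring : Type := {ptws int -> discrete_topology A}.
HB.instance Definition _ := Choice.on bistring.
HB.instance Definition _ := Topological.on bistring.

Definition shift_fun (w : bistring) : bistring := fun n => w (n + 1)%R.
Definition unshift_fun (w : bistring) : bistring := fun n => w (n - 1)%R.

Fact shift_funK : cancel shift_fun unshift_fun.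
Proof. by move=> w; apply/funext => n; rewrite /shift_fun /unshift_fun GRing.subrK. Qed.

Fact unshift_funK : cancel unshift_fun shift_fun.
Proof. by move=> w; apply/funext => n; rewrite /shift_fun /unshift_fun GRing.addrK. Qed.

Definition shift : bijection bistring := Bijection shift_funK unshift_funK.

Definition subword_bi (u : seq A) (w : bistring) : Prop :=
  exists i : int, u = mkseq (fun k => w (i + k%:Z)%R) (size u).

(* Right-infinite strings are indexed from 0 rather than from 1. *)
Definition subword (u : seq A) (xi : nat -> A) : Prop :=
  exists i : nat, u = mkseq (fun k => xi (i + k)%N) (size u).

Definition Omega (xi : nat -> A) : set bistring :=
  [set w | forall u : seq A, u != [::] -> subword_bi u w -> subword u xi].

Lemma subword_bi_shift u w : subword_bi u (shift w) <-> subword_bi u w.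
Proof.
split=> -[i uE].
- exists (i + 1)%R; rewrite [LHS]uE; apply: eq_mkseq => k.
  by rewrite /shift /= /shift_fun GRing.addrAC.
- exists (i - 1)%R; rewrite [LHS]uE; apply: eq_mkseq => k.
  by rewrite /shift /= /shift_fun GRing.addrAC GRing.subrK.
Qed.

Lemma Omega_shift xi w : Omega xi (shift w) <-> Omega xi w.
Proof. by split=> Ow u u0 uw; apply: Ow => //; apply/subword_bi_shift. Qed.

Section Restriction.
Variable xi : nat -> A.

Fact shift_Omega_subproof (w : set_type (Omega xi)) : shift (val w) \in Omega xi.
Proof. by apply/mem_set/Omega_shift/set_mem/valP. Qed.

Fact unshift_Omega_subproof (w : set_type (Omega xi)) :
  (shift^-1%g : bijection _) (val w) \in Omega xi.
Proof.
apply/mem_set/Omega_shift; rewrite [X in Omega _ X](@bij_invK _ shift).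
exact/set_mem/valP.
Qed.

Definition shift_Omega_fun (w : set_type (Omega xi)) : set_type (Omega xi) :=
  Sub (shift (val w)) (shift_Omega_subproof w).
Definition unshift_Omega_fun (w : set_type (Omega xi)) : set_type (Omega xi) :=
  Sub ((shift^-1%g : bijection _) (val w)) (unshift_Omega_subproof w).

Fact shift_Omega_funK : cancel shift_Omega_fun unshift_Omega_fun.
Proof. by move=> w; apply: val_inj; rewrite !SubK; exact: bij_funK. Qed.

Fact unshift_Omega_funK : cancel unshift_Omega_fun shift_Omega_fun.
Proof. by move=> w; apply: val_inj; rewrite !SubK; exact: bij_invK. Qed.

Definition shift_Omega : bijection (set_type (Omega xi)) :=
  Bijection shift_Omega_funK unshift_Omega_funK.

Lemma shift_Omega_homeomorphism : homeomorphism shift_Omega.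
Proof.
have cp (j : int) : continuous (fun w : set_type (Omega xi) => val w j : discrete_topology A).
  have pj : continuous (fun v : bistring => v j : discrete_topology A).
    exact: (@proj_continuous int (fun=> discrete_topology A) j).
  have vc : continuous (val : set_type (Omega xi) -> bistring).
    exact: (@initial_continuous _ bistring val).
  by move=> w; exact: (continuous_comp (vc w) (pj (val w))).
have cS (f : set_type (Omega xi) -> set_type (Omega xi)) (c : int) :
    (forall w n, val (f w) n = val w (n + c)%R) -> continuous f.
  move=> fE; apply: continuous_comp_initial => w.
  have FF : Filter ((set_val \o f) x @[x --> w]) by exact: (fmap_filter _ (nbhs_filter w)).
  apply/cvg_sup => i.
  apply/cvg_image; first by rewrite eqEsubset; split=> // v _; exists (fun=> v).
  move=> U Uw /=; exists [set v : bistring | U (v i)]; last first.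
    by rewrite eqEsubset; split=> [_ [v Uv <-] //|u Uu]; exists (fun=> u).
  have Uw' : nbhs (val w (i + c)%R : discrete_topology A) U by rewrite -fE; exact: Uw.
  apply: (@filterS _ _ (nbhs_filter w) _ _ _ (cp (i + c)%R w U Uw')) => v /=.
  by rewrite -fE.
by split; [exact: (cS _ 1%R) | exact: (cS _ (-1)%R)].
Qed.

End Restriction.
End Subshifts.

Section Substitutions.
Variable A : Type.

Definition subst_word (s : A -> seq A) (u : seq A) : seq A := flatten (map s u).

(* When all words [s b] are nonempty, the images of the first [n.+1] letters
   cover position [n], so the default value of [nth] is never used. *)
Definition subst_string (s : A -> seq A) (xi : nat -> A) : nat -> A :=
  fun n => nth (xi 0%N) (subst_word s (mkseq xi n.+1)) n.

Definition fixed_string (s : A -> seq A) (a : A) : set (nat -> A) :=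
  [set xi | xi 0%N = a /\ subst_string s xi = xi].

End Substitutions.

Section FixedString.
Variables (A : choiceType) (s : A -> seq A) (a : A).

(* "The unique infinite string beginning with [a] preserved by [s]": meaningful
   only under existence and uniqueness, see [fixpoint_string_unique]. *)
Definition fixpoint_string : nat -> A := xget (fun=> a) (fixed_string s a).

Variables (f g : A -> A).
Hypotheses (sE : forall b, s b = [:: f b; g b]) (fa : f a = a).

Let half_map (xi : nat -> A) : nat -> A :=
  fun n => if odd n then g (xi n./2) else f (xi n./2).

Let subst_stringE xi : subst_string s xi = half_map xi.
Proof.
have H d u k : (k./2 < size u)%N ->
    nth d (subst_word s u) k = (if odd k then g else f) (nth d u k./2).
  elim: u k => [|b u IH] [|[|k]] //=; rewrite /subst_word /= sE //=.
  by rewrite negbK ltnS => /IH <-.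
apply/funext => n; rewrite /subst_string H; last first.
  by rewrite size_mkseq ltnS -divn2 leq_div.
rewrite nth_mkseq ?ltnS -?divn2 ?leq_div // /half_map divn2.
by case: (odd n).
Qed.

Let half_fixed_eq (xi xi' : nat -> A) :
  xi 0%N = xi' 0%N -> half_map xi = xi -> half_map xi' = xi' -> xi = xi'.
Proof.
move=> e0 e e'; apply/funext; elim/ltn_ind => -[//|n] IH.
by rewrite -e -e' /half_map IH // -divn2 ltn_Pdiv.
Qed.

Let approx := fix approx (fuel n : nat) : A :=
  if fuel is m.+1 then
    if odd n then g (approx m n./2) else f (approx m n./2)
  else a.

Let approx_enough p q n : (n <= p)%N -> (n <= q)%N -> approx p n = approx q n.
Proof.
have H0 m : approx m 0%N = a by elim: m => //= m ->.
elim: p q n => [|p IH] [|q] [|n] // np nq; rewrite ?H0 //=.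
have hn : (uphalf n <= n)%N by rewrite uphalf_half -[leqRHS]odd_double_half leq_add2l -addnn leq_addr.
by rewrite (IH q (uphalf n)) //; apply: leq_trans hn _.
Qed.

Lemma fixpoint_string_unique :
  fixed_string s a fixpoint_string /\
  forall xi, fixed_string s a xi -> xi = fixpoint_string.
Proof.
have fx : fixed_string s a fixpoint_string.
  rewrite /fixpoint_string; apply: xgetPex.
  exists (fun n => approx n n); split=> //; rewrite subst_stringE.
  apply/funext => -[|n]; first by rewrite /half_map /=.
  rewrite /half_map /= (approx_enough (q := n)) //.
  by rewrite uphalf_half -[leqRHS]odd_double_half leq_add2l -addnn leq_addr.
split=> // xi [x0 xfix]; case: fx => [y0 yfix].
by apply: half_fixed_eq; rewrite -?subst_stringE // x0 y0.
Qed.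

End FixedString.

(* The alphabet {0, 1} is [bool], with [false] for 0 and [true] for 1. *)
Definition subst_TM (b : bool) : seq bool :=
  if b then [:: true; false] else [:: false; true].

Definition xi_TM : nat -> bool := fixpoint_string subst_TM false.

Lemma xi_TM_unique :
  fixed_string subst_TM false xi_TM /\
  forall xi, fixed_string subst_TM false xi -> xi = xi_TM.
Proof. by apply: (@fixpoint_string_unique _ _ _ id negb) => // -[]. Qed.

Inductive pd_letter : Type := pd_x | pd_y.

Definition bool_of_pd_letter l := if l is pd_x then false else true.
Definition pd_letter_of_bool b := if b then pd_y else pd_x.
Fact bool_of_pd_letterK : cancel bool_of_pd_letter pd_letter_of_bool.
Proof. by case. Qed.
HB.instance Definition _ := Finite.copy pd_letter (can_type bool_of_pd_letterK).

Definition subst_pd (l : pd_letter) : seq pd_letter :=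
  match l with pd_x => [:: pd_x; pd_y] | pd_y => [:: pd_x; pd_x] end.

Definition xi_pd : nat -> pd_letter := fixpoint_string subst_pd pd_x.

Lemma xi_pd_unique :
  fixed_string subst_pd pd_x xi_pd /\
  forall xi, fixed_string subst_pd pd_x xi -> xi = xi_pd.
Proof.
apply: (@fixpoint_string_unique _ _ _ (fun=> pd_x)
  (fun l => if l is pd_x then pd_y else pd_x)) => //.
by case.
Qed.

Section Grigorchuk.

Definition scons (T : Type) (x : T) (eta : nat -> T) : nat -> T :=
  fun n => if n is m.+1 then eta m else x.

Definition shead (T : Type) (eta : nat -> T) : T := eta 0%N.
Definition stail (T : Type) (eta : nat -> T) : nat -> T := fun n => eta n.+1.

Lemma sconsE (T : Type) (eta : nat -> T) : scons (shead eta) (stail eta) = eta.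
Proof. by apply/funext => -[]. Qed.

Definition letter0 : 'I_3 := @Ordinal 3 0 isT.
Definition letter1 : 'I_3 := @Ordinal 3 1 isT.
Definition letter2 : 'I_3 := @Ordinal 3 2 isT.

Definition grig_a_fun (eta : nat -> bool) : nat -> bool :=
  scons (~~ shead eta) (stail eta).

(* Common recursion for b, c and d: at the first 0 of the argument, the rest of
   the string is left unchanged if the letter of [omega] at that position is
   [k], and is otherwise transformed by a. The recursion equations are
   [grig_fun0] and [grig_fun1] below. *)
Fixpoint grig_fun (k : 'I_3) (omega : nat -> 'I_3) (eta : nat -> bool)
    (n : nat) {struct n} : bool :=
  if n is m.+1 then
    if shead eta then grig_fun k (stail omega) (stail eta) m
    else if shead omega == k then stail eta m
    else grig_a_fun (stail eta) m
  else shead eta.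

Lemma grig_fun0 k l omega eta :
  grig_fun k (scons l omega) (scons false eta) =
  scons false (if l == k then eta else grig_a_fun eta).
Proof. by apply/funext => -[|n] //=; rewrite /shead /=; case: (l == k). Qed.

Lemma grig_fun1 k l omega eta :
  grig_fun k (scons l omega) (scons true eta) = scons true (grig_fun k omega eta).
Proof. by apply/funext => -[|n]. Qed.

Fact grig_a_funK : involutive grig_a_fun.
Proof. by move=> eta; rewrite /grig_a_fun /shead /stail /= negbK; exact: sconsE. Qed.

Fact grig_funK k omega : involutive (grig_fun k omega).
Proof.
move=> eta; apply/funext => n; elim: n omega eta => [//|n IH] omega eta.
rewrite -(sconsE omega) -(sconsE eta); case: (shead eta).
  by rewrite !grig_fun1 /= IH.
by rewrite !grig_fun0 /=; case: eqP => // _; rewrite grig_a_funK.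
Qed.

Definition grig_a : bijection (nat -> bool) := Bijection grig_a_funK grig_a_funK.
Definition grig_gen k omega : bijection (nat -> bool) :=
  Bijection (grig_funK k omega) (grig_funK k omega).

Definition grig_b := grig_gen letter2.
Definition grig_c := grig_gen letter1.
Definition grig_d := grig_gen letter0.

Lemma grig_bcd omega : grig_b omega = (grig_c omega * grig_d omega)%g.
Proof.
apply: bijectionP => eta; apply/funext => n /=.
elim: n omega eta => [//|n IH] omega eta.
rewrite -(sconsE omega) -(sconsE eta); case: (shead eta).
  by rewrite !grig_fun1 /= IH.
rewrite !grig_fun0 /=.
have [->|->|->] : [\/ shead omega = letter0, shead omega = letter1 | shead omega = letter2].
  case: (shead omega) => -[|[|[|//]]] h; [apply: Or31|apply: Or32|apply: Or33];
  exact: val_inj.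
all: by rewrite /= ?grig_a_funK.
Qed.

Definition grig_group (omega : nat -> 'I_3) : Type :=
  generated_group [set grig_a; grig_b omega; grig_c omega; grig_d omega].
HB.instance Definition _ omega := Group.on (grig_group omega).

Definition omega01 : nat -> 'I_3 := fun n => if odd n then letter1 else letter0.

End Grigorchuk.

(* Main.v *)
(** The forward orbit of 1^infty under the group is a half-line p = 0, 1, 2, ...
    in the order of the Gray code.  Its edges are alternately labelled by a and
    by pairs of the generators b, c, d, and the edge types spell the period
    doubling string; conversely, a window of three letters of that string
    suffices to recognize the label of the middle edge.  Hence a point of the
    subshift (or of an extension of it, such as the Thue-Morse subshift with
    factor map recording whether consecutive letters agree) carries a labelled
    line on which the generators act by moving the origin by at most one step,
    i.e. by powers of the shift.  A word in the generators is trivial in either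
    group iff it fixes every vertex far from the end of the half-line: on one
    side because those vertices are dense in {0,1}^N, on the other because
    windows of the subshift occur in the string, and some point of the subshift
    extends the half-line to the left and is not periodic. *)
From HB Require Import structures.
Require Import Defs.
From mathcomp Require Import all_boot all_order all_algebra.
From mathcomp Require Import all_classical all_reals.
From mathcomp Require Import topology.
From mathcomp Require Import zify.

Set Implicit Arguments.
Unset Strict Implicit.
Unset Printing Implicit Defensive.

(** * Words in involutions and embeddings *)

Definition word_eval (G : groupType) (I : Type) (s : I -> G) (u : seq I) : G :=
  (\prod_(i <- u) s i)%g.

Lemma word_eval_cons (G : groupType) (I : Type) (s : I -> G) (i : I) (u : seq I) :
  word_eval s (i :: u) = (s i * word_eval s u)%g.
Proof. exact: big_cons. Qed.

Lemma word_eval_cat (G : groupType) (I : Type) (s : I -> G) (u v : seq I) :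
  word_eval s (u ++ v) = (word_eval s u * word_eval s v)%g.
Proof. exact: big_cat. Qed.

Lemma word_eval_rev (G : groupType) (I : Type) (s : I -> G) (u : seq I) :
  (forall i, s i * s i = 1)%g -> word_eval s (rev u) = (word_eval s u)^-1%g.
Proof.
move=> ss; elim: u => [|i u IH]; first by rewrite /rev /= /word_eval big_nil invg1.
rewrite rev_cons -cats1 word_eval_cat IH /word_eval big_seq1 big_cons invgM.
by congr (_ * _)%g; apply: (@mulgI _ (s i)); rewrite ss mulgV.
Qed.

Lemma generated_words (G : groupType) (I : Type) (s : I -> G) (S : set G) (g : G) :
  (forall i, s i * s i = 1)%g -> (S `<=` range s)%classic -> generated S g ->
  exists u, word_eval s u = g.
Proof.
move=> ss SE Sg; apply: (Sg [set h | exists u, word_eval s u = h]%classic); split.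
  split; first by apply/mem_set; exists [::]; rewrite /word_eval big_nil.
  move=> x y /set_mem[u <-] /set_mem[v <-]; apply/mem_set; exists (u ++ rev v).
  by rewrite word_eval_cat word_eval_rev.
by move=> x /SE[i _ <-]; exists [:: i]; rewrite /word_eval big_seq1.
Qed.

(** As the generators are involutions, [u] and [v] have equal values iff [u ++ rev v] is a relator.
    With the same relators on both sides, any choice of words for the elements of the generated
    group gives an injective homomorphism. *)
Lemma embeds_words (G H : groupType) (I : Type) (s : I -> G) (t : I -> H) (S : set G) :
  (forall i, s i * s i = 1)%g -> (forall i, t i * t i = 1)%g ->
  (S `<=` range s)%classic ->
  (forall u, word_eval s u = 1%g <-> word_eval t u = 1%g) ->
  embeds (generated_group S) H.
Proof.
move=> ss tt SE st.
have eqE u v : word_eval s u = word_eval s v <-> word_eval t u = word_eval t v.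
  have e (K : groupType) (x : I -> K) : (forall i, x i * x i = 1)%g ->
      word_eval x u = word_eval x v <-> word_eval x (u ++ rev v) = 1%g.
    move=> xx; rewrite word_eval_cat word_eval_rev //.
    by split=> [->|/divg1_eq //]; rewrite mulgV.
  by rewrite !e.
have ex (g : generated_group S) : exists u, word_eval s u = \val g.
  by apply: (generated_words ss SE); exact/set_mem/(valP g).
pose w g := projT1 (cid (ex g)).
have wE g : word_eval s (w g) = \val g := projT2 (cid (ex g)).
pose f g := word_eval t (w g).
have fM : {morph f : x y / (x * y)%g}.
  move=> x y; rewrite /f -word_eval_cat; apply/eqE.
  by rewrite word_eval_cat !wE -gmulfM.
pose F : {multiplicative generated_group S -> H} :=
  HB.pack f (isMultiplicative.Build _ _ f fM).
exists F => x y /eqE.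
by rewrite !wE => /val_inj.
Qed.

(** * Self-similarity of the two strings *)

Lemma fixed_string_halves (A : Type) (s : A -> seq A) (a : A) (f g : A -> A)
    (xi : nat -> A) :
  (forall b, s b = [:: f b; g b]) -> fixed_string s a xi ->
  forall n, xi n.*2 = f (xi n) /\ xi n.*2.+1 = g (xi n).
Proof.
move=> sE [_ fix_xi] n.
have H d u k : (k < size u)%N -> nth d (subst_word s u) k.*2 = f (nth d u k) /\
    nth d (subst_word s u) k.*2.+1 = g (nth d u k).
  elim: u k => [|b u IH] [|k] //=; rewrite /subst_word /= sE //=.
  by rewrite ltnS => /IH.
have Hn k : (n < k.+1)%N ->
    nth (xi 0) (subst_word s (mkseq xi k.+1)) n.*2 = f (xi n) /\
    nth (xi 0) (subst_word s (mkseq xi k.+1)) n.*2.+1 = g (xi n).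
  move=> nk; have := H (xi 0) (mkseq xi k.+1) n.
  by rewrite size_mkseq (nth_mkseq (xi 0) xi nk); exact.
have n1 : (n < n.*2.+1)%N by lia.
by split; rewrite -{1}fix_xi; [exact: (Hn _ n1).1|exact: (Hn _ (leqW n1)).2].
Qed.

Definition pd_seq (n : nat) : bool := bool_of_pd_letter (xi_pd n).

Lemma xi_pdE n : xi_pd n = pd_letter_of_bool (pd_seq n).
Proof. by rewrite /pd_seq bool_of_pd_letterK. Qed.

Lemma pd_seq_halves n : pd_seq n.*2 = false /\ pd_seq n.*2.+1 = ~~ pd_seq n.
Proof.
rewrite /pd_seq; have [|-> ->] := @fixed_string_halves _ subst_pd pd_x (fun=> pd_x)
  (fun l => if l is pd_x then pd_y else pd_x) xi_pd _ xi_pd_unique.1 n.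
  by case.
by case: (xi_pd n).
Qed.

Lemma pd_seq_even n : ~~ odd n -> pd_seq n = false.
Proof. by move=> /even_halfK <-; rewrite (pd_seq_halves _).1. Qed.

Lemma xi_TM_halves n : xi_TM n.*2 = xi_TM n /\ xi_TM n.*2.+1 = ~~ xi_TM n.
Proof. by apply: (@fixed_string_halves _ subst_TM false id negb) xi_TM_unique.1 n; case. Qed.

(** Both sides satisfy the recursion of [pd_seq_halves]: the block 01 or 10 at [n.*2] has distinct
    letters, and across a block boundary a complemented letter meets an uncomplemented one. *)
Lemma xi_TM_pd n : (xi_TM n == xi_TM n.+1) = pd_seq n.
Proof.
elim/ltn_ind: n => n IH; rewrite -(odd_double_half n); case on: (odd n) => /=.
  rewrite add1n -doubleS !(xi_TM_halves _).1 (xi_TM_halves _).2 (pd_seq_halves _).2 -IH.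
    by case: (xi_TM _) (xi_TM _) => -[].
  by rewrite ltn_half_double; case: n on {IH} => // n _; lia.
rewrite add0n (xi_TM_halves _).1 (xi_TM_halves _).2 (pd_seq_halves _).1.
by case: (xi_TM _).
Qed.

(** * Labelled lines and walks *)

(* Label of the edge between the vertices [n] and [n.+1] of the half-line: [None]
   for a, and [Some d] for the pair b, c if [d] holds and b, d otherwise. *)
Definition label (n : nat) : option bool := if odd n then Some (pd_seq n) else None.

(* Generators are coded by [option 'I_3]: [None] is a and [Some k] is [grig_gen k]. *)
Definition active (i : option 'I_3) (e : option bool) : bool :=
  match i, e with
  | None, None => true
  | Some k, Some d => (if d then letter0 else letter1) != k
  | _, _ => false
  end.

(** Edge [n] joins [n] and [n + 1]. When a and pair labels alternate, at most one edge at [p] is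
    active, so the order of the tests is immaterial. *)
Definition step (i : option 'I_3) (E : int -> option bool) (p : int) : int :=
  (if active i (E p) then p + 1 else if active i (E (p - 1)) then p - 1 else p)%R.

Definition walk (u : seq (option 'I_3)) (E : int -> option bool) (p : int) : int :=
  foldr (fun i => step i E) p u.

(** * The generators on the Gray code half-line *)

Definition grig_gens (i : option 'I_3) : bijection (nat -> bool) :=
  if i is Some k then grig_gen k omega01 else grig_a.

(* The complemented reflected Gray code, so that [gray 0] is 1^infty. *)
Definition gray (p n : nat) : bool := odd (iter n half p) == odd (iter n.+1 half p).

Lemma grayE p : gray p = scons (odd p == odd p./2) (gray p./2).
Proof. by apply/funext => -[|n] //=; rewrite /gray -iterSr -iterSr. Qed.

Lemma gray_inj : injective gray.
Proof.
move=> p q; have [N [pN qN]] : exists N, p <= N /\ q <= N by exists (p + q); lia.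
elim: N p q pN qN => [|N IH] p q pN qN gpq; first by lia.
have pq2 : p./2 = q./2.
  apply: IH; [lia|lia|]; apply/funext => n.
  by have := congr1 (fun f => f n.+1) gpq; rewrite (grayE p) (grayE q).
have := congr1 (fun f => f 0) gpq; rewrite (grayE p) (grayE q) /= pq2.
lia.
Qed.

Lemma gray_double m :
  gray m.*2 = scons (~~ odd m) (gray m) /\ gray m.*2.+1 = scons (odd m) (gray m).
Proof.
rewrite (grayE m.*2) (grayE m.*2.+1) /= uphalf_double doubleK odd_double.
by case: (odd m).
Qed.

Lemma grig_a_gray m : grig_a_fun (gray m.*2) = gray m.*2.+1.
Proof.
by rewrite (gray_double m).1 (gray_double m).2 /grig_a_fun /shead /stail /= negbK.
Qed.

(** The tails of [omega01], over which the induction in [grig_gray] must range. *)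
Definition omega01_from (b : bool) : nat -> 'I_3 :=
  fun n => if odd n (+) b then letter1 else letter0.

Lemma omega01_fromE b :
  omega01_from b = scons (if b then letter1 else letter0) (omega01_from (~~ b)).
Proof. by apply/funext => -[|n] //; rewrite /omega01_from /=; case: (odd n) b => -[]. Qed.

(** The two endpoints share their first bit, and their tails are [gray m] and [gray m.+1]. For odd
    [m] that bit is 1: recurse to edge [m], where the letter of [pd_seq] and the phase of
    [omega01_from] both flip. For even [m] it is 0 and a swaps the tails. *)
Lemma grig_gray k b m :
  let fixed := (if pd_seq m.*2.+1 (+) b then letter0 else letter1) == k in
  grig_fun k (omega01_from b) (gray m.*2.+1) = gray (if fixed then m.*2.+1 else m.*2.+2) /\
  grig_fun k (omega01_from b) (gray m.*2.+2) = gray (if fixed then m.*2.+2 else m.*2.+1).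
Proof.
elim/ltn_ind: m b => m IH b /=; rewrite !(fun_if gray) omega01_fromE.
rewrite -[m.*2.+2]/(m.+1.*2) (gray_double m).2 (gray_double m.+1).1 /=.
rewrite (pd_seq_halves _).2 negbK.
have [mo|me] := boolP (odd m).
  have /IH {}IH : m./2 < m by rewrite ltn_half_double; case: m mo {IH} => // m _; lia.
  have := IH (~~ b); rewrite odd_halfK // -/(m.-1.+2) prednK; last by case: m mo {IH}.
  rewrite /= !(fun_if gray) !grig_fun1 => -[-> ->]; rewrite addbN addNb.
  by case: eqP.
have -> : gray m.+1 = grig_a_fun (gray m) by rewrite -(even_halfK me) grig_a_gray.
by rewrite !grig_fun0 grig_a_funK pd_seq_even //; case: b {IH} => /=; case: eqP.
Qed.

Lemma grig_gens_invol i : (grig_gens i * grig_gens i = 1)%g.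
Proof. by apply: bijectionP => eta; case: i => [k|]; [exact: grig_funK|exact: grig_a_funK]. Qed.

Lemma grig_gens_range :
  ([set grig_a; grig_b omega01; grig_c omega01; grig_d omega01] `<=` range grig_gens)%classic.
Proof.
by move=> _ [[[->|->]|->]|->];
  [exists None|exists (Some letter2)|exists (Some letter1)|exists (Some letter0)].
Qed.

Lemma grig_gens_gray i m :
  grig_gens i (gray m.*2.+1) =
    gray (if active i (label m.*2.+1) then m.*2.+2 else
          if active i None then m.*2 else m.*2.+1) /\
  grig_gens i (gray m.*2.+2) =
    gray (if active i (label m.*2.+1) then m.*2.+1 else
          if active i None then m.*2.+3 else m.*2.+2).
Proof.
rewrite /label /= odd_double /=; case: i => [k|] /=; last first.
  by rewrite -grig_a_gray -[m.*2.+2]/(m.+1.*2) -[m.*2.+3]/(m.+1.*2.+1) -grig_a_gray grig_a_funK.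
have := grig_gray k false m; rewrite addbF.
have -> : omega01_from false = omega01 by apply/funext => n; rewrite /omega01_from addbF.
by case: eqP.
Qed.

Lemma grig_gens_step i (E : int -> option bool) (p : nat) :
  (0 < p)%N -> E p = label p -> E p.-1 = label p.-1 ->
  exists q : nat, [/\ step i E p = q, grig_gens i (gray p) = gray q, p <= q.+1 & q <= p.+1].
Proof.
move=> p0 Ep Ep1; have pB : (p%:Z - 1 = p.-1 :> int)%R by lia.
have pD : (p%:Z + 1 = p.+1 :> int)%R by lia.
rewrite /step pB pD Ep Ep1 {Ep Ep1 pB pD}.
have [podd|peven] := boolP (odd p).
  have [m pE] : exists m, p = m.*2.+1 by exists p./2; lia.
  rewrite pE /= in podd p0 *; have [e _] := grig_gens_gray i m.
  have -> : label m.*2 = None by rewrite /label odd_double.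
  case: ifP e => [_ e|_]; first by exists m.*2.+2; split=> //; lia.
  case: ifP => [_ e|_ e]; first by exists m.*2; split=> //; lia.
  by exists m.*2.+1; split=> //; lia.
have [m pE] : exists m, p = m.*2.+2 by exists p./2.-1; lia.
rewrite pE /= in peven p0 *; have [_ e] := grig_gens_gray i m.
have -> : label m.*2.+2 = None by rewrite /label /= (negbTE peven).
have dis : active i (label m.*2.+1) -> ~~ active i None.
  by case: (i) => //; rewrite /label /= odd_double.
case: ifP dis e => [iN|_].
  case: ifP => [_ /(_ isT)|_ _ e] //.
  by exists m.*2.+1; split=> //; lia.
case: ifP => [_ _ e|_ _ e]; first by exists m.*2.+3; split=> //; lia.
by exists m.*2.+2; split=> //; lia.
Qed.

(** A walk of at most [L] steps stays within [L] of [p]; before each step the vertex is positive and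
    both its edges lie in the window. *)
Lemma walk_gray u (E : int -> option bool) (p L : nat) :
  size u <= L -> L <= p ->
  (forall n : nat, p <= n + L -> n <= p + L -> E n = label n) ->
  exists q : nat, [/\ walk u E p = q, word_eval grig_gens u (gray p) = gray q,
    p <= q + size u & q <= p + size u].
Proof.
move=> uL Lp EL; elim: u uL => [|i u IH] uL.
  by exists p; rewrite /word_eval big_nil; split=> //; lia.
have [|q [wq gq pq qp]] := IH; first exact: ltnW.
move: uL => /= uL.
have [||| q' [sq gq' qq' q'q]] := @grig_gens_step i E q; [lia|by apply: EL; lia|by apply: EL; lia|].
exists q'; split; [by rewrite /= wq|by rewrite word_eval_cons bijM gq|lia|lia].
Qed.

(** The generators are automorphisms of the binary tree, so triviality of a word can be tested on a
    dense set of strings. *)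
Lemma grig_gens_prefix i n (eta eta' : nat -> bool) :
  (forall k, k < n -> eta k = eta' k) ->
  forall k, k < n -> grig_gens i eta k = grig_gens i eta' k.
Proof.
have aP (x y : nat -> bool) m : (forall k, k < m -> x k = y k) ->
    forall k, k < m -> grig_a_fun x k = grig_a_fun y k.
  by move=> xy [|k] km; [rewrite /= /shead xy|exact: xy].
case: i => [l|]; last exact: aP.
rewrite /grig_gens /=; move: omega01; elim: n eta eta' => // n IH eta eta' om e [|k] kn /=.
  exact: e.
rewrite /shead e //; case: ifP => _.
  by apply: IH => // j jn; exact: e.
have e' j : j < n -> stail eta j = stail eta' j by move=> jn; exact: e.
by case: ifP => _; [exact: e'|exact: (aP _ _ n)].
Qed.

Lemma word_prefix u n (eta eta' : nat -> bool) :
  (forall k, k < n -> eta k = eta' k) ->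
  forall k, k < n -> word_eval grig_gens u eta k = word_eval grig_gens u eta' k.
Proof.
move=> e; elim: u => [|i u IH]; first by rewrite /word_eval big_nil.
by rewrite word_eval_cons => k kn; rewrite !bijM; apply: grig_gens_prefix kn.
Qed.

(** Prepending either bit to [gray q] gives [gray q.*2] or [gray q.*2.+1]. *)
Lemma gray_dense (eta : nat -> bool) L n :
  exists2 p, L <= p & forall k, k < n -> gray p k = eta k.
Proof.
elim: n eta => [|n IH] eta; first by exists L.
have [q Lq qE] := IH (stail eta).
exists (if eta 0 == odd q then q.*2.+1 else q.*2); first by case: ifP; lia.
move=> k; case: ifP => e; rewrite ?(gray_double q).1 ?(gray_double q).2;
  case: k => [|k] kn; rewrite /= ?qE //; move: e;
  by case: (odd q) (eta 0) => -[].
Qed.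

Lemma word_eval_trivial u :
  (forall p, size u <= p -> word_eval grig_gens u (gray p) = gray p) ->
  word_eval grig_gens u = 1%g.
Proof.
move=> up; apply: bijectionP => eta; apply/funext => n.
have [p Lp pE] := gray_dense eta (size u) n.+1.
have pE' k : k < n.+1 -> eta k = gray p k by move=> /pE.
by rewrite (word_prefix u pE' (ltnSn n)) up // pE.
Qed.

(** * Aperiodicity and recognizability *)

(** An even period can be halved by looking at odd positions; an odd one would carry the zeros at
    even positions to odd positions. *)
Lemma pd_seq_aperiodic n N : (forall k, N <= k -> pd_seq (k + n) = pd_seq k) -> n = 0.
Proof.
elim/ltn_ind: n N => n IH N per; have [no|ne] := boolP (odd n); last first.
  have n2 : n./2 = 0 \/ n = 0.
    have [->|n0] := posnP n; [by right|left].
    apply: (IH _ _ N); first by rewrite ltn_half_double; lia.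
    move=> k Nk; apply: negb_inj; rewrite -!(pd_seq_halves _).2 -(per k.*2.+1); last by lia.
    by congr pd_seq; lia.
  by case: n2 => //; lia.
have ev m : N <= m -> odd m -> pd_seq m = false.
  by move=> Nm mo; rewrite -(per m) // pd_seq_even // oddD mo no.
(* Position 4N+1 is odd, beyond [N], and carries [true]. *)
have := ev (N.*2.*2).+1; rewrite (pd_seq_halves N.*2).2 (pd_seq_halves N).1 /=.
by rewrite odd_double => /(_ _ isT) e; suff: true = false by []; apply: e; lia.
Qed.

Lemma pd_seq_shift_inj p q : (forall n, pd_seq (n + p) = pd_seq (n + q)) -> p = q.
Proof.
wlog pq : p q / p <= q => [H pqE|pqE].
  by case: (leqP p q) => [/H|/ltnW /H h]; [apply|apply/esym/h].
suff: q - p = 0 by lia.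
apply: (@pd_seq_aperiodic _ p) => k pk.
by have := pqE (k - p); rewrite subnK // => ->; congr pd_seq; lia.
Qed.

(** A [true] letter sits at an odd position, so a [true] neighbour makes [n.+1] even. Conversely, of
    two consecutive odd positions 2m+1 and 2m+3 one carries [true], since [m] or [m.+1] is even. *)
Lemma labelE n : label n.+1 = if pd_seq n || pd_seq n.+2 then None else Some (pd_seq n.+1).
Proof.
rewrite /label /=; have [no|ne] := boolP (odd n); last first.
  by rewrite (@pd_seq_even n) // (@pd_seq_even n.+2) //= negbK.
have [m ->] : exists m, n = m.*2.+1 by exists n./2; lia.
rewrite -[m.*2.+3]/(m.+1.*2.+1) !(pd_seq_halves _).2.
by have [mo|/pd_seq_even -> //] := boolP (odd m); rewrite (@pd_seq_even m.+1) ?orbT //= mo.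
Qed.

Lemma label_alternate n : (label n == None) = (label n.+1 != None).
Proof. by rewrite /label /=; case: (odd n). Qed.

(** By alternation the active edges of a generator form a matching, whose endpoints it swaps. *)
Lemma step_invol i (E : int -> option bool) (p : int) :
  (forall n, (E n == None) = (E (n + 1)%R != None)) -> step i E (step i E p) = p.
Proof.
move=> alt; have act n : active i (E n) -> ~~ active i (E (n + 1)%R).
  by move: (alt n); case: i (E n) (E (n + 1)%R) => [k|] [d|] [d'|].
rewrite {2}/step; case: ifP => [a0|n0].
  by rewrite /step (negbTE (act _ a0)) GRing.addrK a0.
case: ifP => [a1|n1]; first by rewrite /step a1 GRing.subrK.
by rewrite /step n0 n1.
Qed.

Lemma walk_translate u (E : int -> option bool) (k p : int) :
  walk u (fun n => E (n + k)%R) p = (walk u E (p + k) - k)%R.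
Proof.
elim: u => /= [|i u ->]; first by rewrite GRing.addrK.
rewrite /step /= GRing.subrK (GRing.addrAC _ (- 1)%R) GRing.subrK.
by case: ifP => _; [|case: ifP => _]; lia.
Qed.

(** * The action on the subshift by powers of the shift *)

Section SubshiftAction.
Variables (A : finType) (xi : nat -> A) (g : A -> A -> bool).
Hypothesis g_xi : forall n, g (xi n) (xi n.+1) = pd_seq n.

Local Notation T := (shift_Omega xi).
Implicit Types (w : set_type (Omega xi)) (i : option 'I_3).

Definition factor w (n : int) : bool := g (val w n) (val w (n + 1)%R).

(** The formula of [labelE], which does not refer to the parity of the position. *)
Definition edge w (n : int) : option bool :=
  if factor w (n - 1)%R || factor w (n + 1)%R then None else Some (factor w n).

Lemma expgz_shiftE (k : int) w n : val (expgz T k w) n = val w (n + k)%R.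
Proof.
have pos (m : nat) v j : val (expgz T m v) j = val v (j + m)%R.
  elim: m v j => [|m IH] v j; first by rewrite GRing.addr0.
  rewrite /= expgS bijM /= /shift_fun (IH v).
  by congr (val v _); lia.
case: (intP k) => [|m|m]; [exact: (pos 0)|exact: pos|].
have := pos m.+1 (expgz T (- m.+1%:Z)%R w) (n - m.+1%:Z)%R.
by rewrite -bijM -expgzD GRing.subrr GRing.subrK => ->.
Qed.

Lemma edge_shift k w : edge (expgz T k w) = (fun n => edge w (n + k)%R).
Proof.
apply/funext => n; rewrite /edge /factor !expgz_shiftE.
by rewrite !(GRing.addrAC _ _ k).
Qed.

Lemma factor_edge w (n : nat) :
  factor w n = pd_seq n -> factor w n.+1 = pd_seq n.+1 -> factor w n.+2 = pd_seq n.+2 ->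
  edge w n.+1 = label n.+1.
Proof.
rewrite labelE /edge => e0 e1 e2.
have -> : (n.+1%:Z - 1 = n)%R by lia.
have -> : (n.+1%:Z + 1 = n.+2)%R by lia.
by rewrite e0 e1 e2.
Qed.

Lemma edge_window w L : exists2 p : nat, L <= p &
  forall n : nat, p <= n + L -> n <= p + L -> edge w (n%:Z - p%:Z)%R = label n.
Proof.
(* Edges -L to L involve factor letters -L-1 to L+1, hence letters of [w] from -L-1 to L+2. The
   origin of [w] corresponds to [p = j + L.+1]. *)
pose u := mkseq (fun k => val w (- L.+1%:Z + k%:Z)%R) (L + L).+4.
have [||j uE] := set_mem (valP w) u; [by []|by exists (- L.+1%:Z)%R; rewrite size_mkseq|].
rewrite size_mkseq in uE.
have wxi n : j <= n -> n < j + (L + L).+4 -> val w (n%:Z - (j + L.+1)%:Z)%R = xi n.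
  move=> jn nj; have := congr1 (fun v => nth (xi 0) v (n - j)) uE.
  rewrite !nth_mkseq; [|lia|lia]; rewrite subnKC // => <-.
  by congr (val w _); lia.
have fac n : j <= n -> n < j + (L + L).+3 -> factor w (n%:Z - (j + L.+1)%:Z)%R = pd_seq n.
  move=> jn nj; rewrite /factor -g_xi -!wxi; [|lia|lia|lia|lia].
  by congr (g _ (val w _)); lia.
exists (j + L.+1) => [|n pn np]; first by lia.
have n0 : (0 < n)%N by lia.
rewrite -(prednK n0).
have -> : edge w (n.-1.+1%:Z - (j + L.+1)%:Z)%R =
   edge (expgz T (- (j + L.+1)%:Z)%R w) n.-1.+1 by rewrite edge_shift.
have fS m : factor (expgz T (- (j + L.+1)%:Z)%R w) m = factor w (m - (j + L.+1)%:Z)%R.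
  by rewrite /factor !expgz_shiftE (GRing.addrAC _ 1%R).
by apply: factor_edge; rewrite fS fac //; lia.
Qed.

Lemma edge_alternate w n : (edge w n == None) = (edge w (n + 1)%R != None).
Proof.
have [p Lp pE] := edge_window w (absz n).+1.
have [m mE] : exists m : nat, (m%:Z = n + p%:Z)%R by exists (absz (n + p%:Z)%R); lia.
have -> : n = (m%:Z - p%:Z)%R by lia.
have -> : (m%:Z - p%:Z + 1 = m.+1%:Z - p%:Z)%R by lia.
by rewrite !pE ?(label_alternate m) //; lia.
Qed.

Definition move_fun i w : set_type (Omega xi) := expgz T (step i (edge w) 0%R) w.

Lemma move_funK i : involutive (move_fun i).
Proof.
move=> w; rewrite /move_fun; set k := step i (edge w) 0%R.
rewrite -bijM -expgzD edge_shift.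
have -> : step i (fun n => edge w (n + k)%R) 0%R = (step i (edge w) k - k)%R.
  by have := walk_translate [:: i] (edge w) k 0; rewrite /= GRing.add0r.
by rewrite GRing.subrK step_invol //; exact: edge_alternate.
Qed.

Definition move i : bijection (set_type (Omega xi)) :=
  Bijection (move_funK i) (move_funK i).

(** Shifting [w] by [k] puts vertex [k] of its line at the origin, so successive moves form one walk
    on the line of [w]. *)
Lemma word_eval_move u w : word_eval move u w = expgz T (walk u (edge w) 0%R) w.
Proof.
elim: u => [|i u IH]; first by rewrite /word_eval big_nil.
rewrite word_eval_cons bijM IH /= /move_fun -bijM -expgzD edge_shift.
set k := walk _ _ _; have := walk_translate [:: i] (edge w) k 0; rewrite /= GRing.add0r => ->.
by rewrite GRing.subrK.
Qed.

Lemma coordinate_near w (j : int) : \forall v \near w, val v j = val w j.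
Proof.
have pj : continuous (fun v : bistring A => v j : discrete_topology A).
  exact: (@proj_continuous int (fun=> discrete_topology A) j).
have vc : continuous (val : set_type (Omega xi) -> bistring A).
  exact: (@initial_continuous _ (bistring A) val).
have h := continuous_comp (vc w) (pj (val w)) (discrete_set1 _).
by apply: (@filterS _ _ (nbhs_filter w) _ _ _ h) => v.
Qed.

Lemma step_near i w : \forall v \near w, step i (edge v) 0%R = step i (edge w) 0%R.
Proof.
have fn n : \forall v \near w, factor v n = factor w n.
  by apply: (@filterS2 _ _ (nbhs_filter w) _ _ _ _
    (coordinate_near w n) (coordinate_near w (n + 1)%R)) => v; rewrite /factor => -> ->.
have en n : \forall v \near w, edge v n = edge w n.
  by apply: (@filterS3 _ _ (nbhs_filter w) _ _ _ _ _
    (fn (n - 1)%R) (fn n) (fn (n + 1)%R)) => v; rewrite /edge => -> -> ->.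
by apply: (@filterS2 _ _ (nbhs_filter w) _ _ _ _ (en 0%R) (en (0 - 1)%R)) => v;
  rewrite /step => -> ->.
Qed.

Lemma move_full_group i : full_group_set T (move i).
Proof.
have cm : continuous (move i).
  move=> w; set k := step i (edge w) 0%R.
  have cT : continuous (expgz T k).
    have [c c'] := shift_Omega_homeomorphism xi.
    have cX (F : bijection (set_type (Omega xi))) m : continuous F -> continuous (F ^+ m)%g.
      move=> cF; elim: m => [|m IH] x; first exact: cvg_id.
      by rewrite expgS; apply: continuous_comp; [exact: IH|exact: cF].
    by rewrite /expgz; case: (k) => m; [exact: cX|rewrite -expVgn; exact: cX].
  (* Near [w] the move is a single power of the shift. *)
  have e : {near w, expgz T k =1 move i}.
    by apply: (@filterS _ _ (nbhs_filter w) _ _ _ (step_near i w)) => v; rewrite /= /move_fun => ->.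
  apply: cvg_trans (near_eq_cvg e) _.
  exact: cT.
split; first by split=> //; have -> : (move i)^-1%g = move i by exact: bijectionP.
exists (fun w => step i (edge w) 0%R); split=> // w; apply/discrete_cvg.
  exact: (fmap_filter _ (nbhs_filter w)).
by apply: (@filterS _ _ (nbhs_filter w) _ _ _ (step_near i w)) => v /= ->.
Qed.

Definition full_move i : full_group T := Sub (move i) (mem_set (move_full_group i)).

Lemma full_move_invol i : (full_move i * full_move i = 1)%g.
Proof. by apply: val_inj; rewrite gmulfM gmulf1 /=; apply: bijectionP => w; exact: move_funK. Qed.

Lemma embeds_full_group w0 : (forall n : nat, factor w0 n = pd_seq n) ->
  embeds (grig_group omega01) (full_group T).
Proof.
move=> w0E; apply: (embeds_words (s := grig_gens) (t := full_move));
  [exact: grig_gens_invol|exact: full_move_invol|exact: grig_gens_range|] => u.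
have valE : val (word_eval full_move u) = word_eval move u by rewrite /word_eval gmulf_prod.
split=> [u1|u1].
  apply: val_inj; rewrite valE gmulf1; apply: bijectionP => w; rewrite word_eval_move.
  have [p Lp pE] := edge_window w (size u).
  have [q [wq gq _ _]] := @walk_gray u (fun n => edge w (n - p%:Z)%R) p (size u) (leqnn _) Lp pE.
  rewrite u1 /= in gq; have pq := gray_inj gq.
  rewrite walk_translate GRing.subrr GRing.opprK -pq in wq.
  by rewrite (_ : walk u (edge w) 0%R = 0%R) //; apply: (@GRing.addIr _ (Posz p));
    rewrite wq GRing.add0r.
apply: word_eval_trivial => p Lp.
have [n _ _|q [wq gq _ _]] := @walk_gray u (edge w0) p (size u) (leqnn _) Lp _.
  case: n => [|n]; last exact: factor_edge.
  (* Edge 0 also involves the unknown factor letter at -1, but the [true] at 1 already forces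
     [None]. *)
  by rewrite /edge GRing.add0r (w0E 1) (pd_seq_halves 0).2 (pd_seq_halves 0).1 orbT.
(* The word sends the [p]-th shift of [w0] to the [q]-th; as it acts trivially, the two coincide and
   aperiodicity gives [p = q]. *)
rewrite gq; congr gray; apply: pd_seq_shift_inj => n.
have := congr1 (fun F : full_group T => val F (expgz T p w0)) u1.
rewrite valE gmulf1 word_eval_move edge_shift walk_translate GRing.add0r wq -bijM -expgzD.
rewrite GRing.subrK => e; rewrite -!w0E.
have := congr1 (fun w => factor w n) e; rewrite /factor !expgz_shiftE.
by rewrite !(GRing.addrAC _ 1%R).
Qed.

End SubshiftAction.

(** * Two-sided points extending the half-line *)

(** [l] is read leftwards, with [l 0] at position -1. *)
Definition glue (A : finType) (l r : nat -> A) : bistring A :=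
  fun n => match n with Posz m => r m | Negz m => l m end.

Lemma glue_Omega (A : finType) (xi l r : nat -> A) :
  (forall N, exists2 p, N <= p &
    forall n, n < N -> xi (p + n) = r n /\ xi (p - n.+1) = l n) ->
  Omega xi (glue l r).
Proof.
move=> H u _ [i uE]; have [p Np pE] := H (absz i + size u).+1.
have [j jE] : exists j : nat, (j%:Z = i + p%:Z)%R by exists (absz (i + p%:Z)%R); lia.
exists j; rewrite uE size_mkseq; apply/eq_in_map => k; rewrite mem_iota add0n => /= ku.
case e : (i + k%:Z)%R => [m|m] /=.
  by rewrite -(pE m _).1; [congr xi|]; lia.
by rewrite -(pE m _).2; [congr xi|]; lia.
Qed.

(** [pd_seq n] is the parity of the 2-adic valuation of n+1, and 2^k + (i+1) and 2^k - (i+1) have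
    the valuation of i+1. *)
Lemma pd_seq_pow2 k i : i.+1 < 2 ^ k ->
  pd_seq (2 ^ k + i) = pd_seq i /\ pd_seq (2 ^ k - i.+2) = pd_seq i.
Proof.
elim: k i => [|k IH] i; [by rewrite expn0; lia|rewrite expnS mul2n => ik].
have [io|ie] := boolP (odd i); last by rewrite !pd_seq_even //; lia.
have [m iE] : exists m, i = m.*2.+1 by exists i./2; lia.
have [|e e'] := IH m; first by lia.
have -> : (2 ^ k).*2 + i = (2 ^ k + m).*2.+1 by lia.
have -> : (2 ^ k).*2 - i.+2 = (2 ^ k - m.+2).*2.+1 by lia.
by rewrite iE !(pd_seq_halves _).2 e e'.
Qed.

Lemma pd_seq_pow2_pred k : pd_seq (2 ^ k).-1 = odd k.
Proof.
elim: k => [|k IH]; first exact: (pd_seq_halves 0).1.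
have k0 : (0 < 2 ^ k)%N by rewrite expn_gt0.
have -> : (2 ^ k.+1).-1 = (2 ^ k).-1.*2.+1 by rewrite expnS; lia.
by rewrite (pd_seq_halves _).2 IH.
Qed.

(** [xi_TM n] is the parity of the binary digit sum of [n]: adding 2^k adds one digit 1, and
    subtracting from 2^k - 1 complements [k] digits. *)
Lemma xi_TM_pow2 k i : i < 2 ^ k ->
  xi_TM (2 ^ k + i) = ~~ xi_TM i /\ xi_TM (2 ^ k - i.+1) = xi_TM i (+) odd k.
Proof.
elim: k i => [|k IH] i.
  by case: i => // _; split; [exact: (xi_TM_halves 0).2|rewrite addbF].
rewrite expnS mul2n => ik.
have [|e e'] := IH i./2; first by lia.
have [io|ie] := boolP (odd i).
  have ti : xi_TM i = ~~ xi_TM i./2 by rewrite -(xi_TM_halves _).2; congr xi_TM; lia.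
  have -> : (2 ^ k).*2 + i = (2 ^ k + i./2).*2.+1 by lia.
  have -> : (2 ^ k).*2 - i.+1 = (2 ^ k - i./2.+1).*2 by lia.
  rewrite !(xi_TM_halves _).1 (xi_TM_halves _).2 e e' ti.
  by rewrite /= addNb addbN !negbK.
have -> : (2 ^ k).*2 + i = (2 ^ k + i./2).*2 by lia.
have -> : (2 ^ k).*2 - i.+1 = (2 ^ k - i./2.+1).*2.+1 by lia.
have ti : xi_TM i = xi_TM i./2 by rewrite -[in LHS](even_halfK ie) (xi_TM_halves _).1.
by rewrite (xi_TM_halves _).1 (xi_TM_halves _).2 e e' ti /= addbN.
Qed.

(* Parity of [k] matters: the letter of the period doubling string at [2 ^ k - 1]
   alternates with [k], as does the left half of the Thue-Morse window. *)
Lemma embeds_glue (A : finType) (xi l r : nat -> A) (g : A -> A -> bool) :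
  (forall n, g (xi n) (xi n.+1) = pd_seq n) ->
  (forall n, g (r n) (r n.+1) = pd_seq n) ->
  (forall k n, ~~ odd k -> n.+1 < 2 ^ k ->
    xi (2 ^ k + n) = r n /\ xi (2 ^ k - n.+1) = l n) ->
  embeds (grig_group omega01) (full_group (shift_Omega xi)).
Proof.
move=> g_xi g_r H; have Ow : glue l r \in Omega xi.
  apply/mem_set/glue_Omega => N; have Nlt := ltn_expl N.*2 (isT : 1 < 2).
  exists (2 ^ N.*2) => [|n nN]; first by lia.
  by apply: H; rewrite ?odd_double //; lia.
apply: (@embeds_full_group _ _ _ g_xi (exist _ (glue l r) Ow)) => n.
by rewrite /factor (_ : (n%:Z + 1 = n.+1)%R); [rewrite -g_r|lia].
Qed.

Theorem theorem1p1 :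
  embeds (grig_group omega01) (full_group (shift_Omega xi_TM)) /\
  embeds (grig_group omega01) (full_group (shift_Omega xi_pd)).
Proof.
split.
  (* To the right of 2^k the string is complemented, which preserves equality of neighbours. *)
  apply: (@embeds_glue _ _ xi_TM (negb \o xi_TM) (fun x y => x == y)).
  - exact: xi_TM_pd.
  - by move=> n /=; rewrite (inj_eq negb_inj) xi_TM_pd.
  - move=> k n /negbTE ke nk; have [|-> ->] := @xi_TM_pow2 k n; first by lia.
    by rewrite ke addbF.
(* For even [k] the letter at 2^k - 1 is [pd_x]; to its left the string is mirrored. *)
apply: (@embeds_glue _ _ (fun n => if n is m.+1 then xi_pd m else pd_x) xi_pd
  (fun x _ => bool_of_pd_letter x)) => // k n /negbTE ke nk.
rewrite !xi_pdE (pd_seq_pow2 nk).1; split=> //; case: n nk => [|n] nk.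
  by rewrite subn1 pd_seq_pow2_pred ke.
by rewrite xi_pdE (pd_seq_pow2 (ltnW nk)).2.
Qed.
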